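(* Let $a,b,c$ be positive integers. Let $\mathrm{PP}(a,b,c)$ be the set of plane partitions with at most $b$ nonzero rows, at most $a$ nonzero columns (i.e. first row of the shape of length at most $a$), and all entries at most $c$. Let $\mathrm{BM}(a,b,c)$ be the set of $b\times c$ matrices $D=(d_{i\ell})$ with entries in $\mathbb N=\{0,1,2,\dots\}$ whose last passage time $G(b,c)=\max_\Pi\sum_{(i,\ell)\in\Pi}d_{i\ell}$ satisfies $G(b,c)\le a$, where the maximum is over monotone lattice paths $\Pi$ from $(1,1)$ to $(b,c)$ using steps $(i,\ell)\to(i+1,\ell)$ and $(i,\ell)\to(i,\ell+1)$. Then the map $\Phi$ restricts to a bijection from $\mathrm{PP}(a,b,c)$ onto $\mathrm{BM}(a,b,c)$.
   Context: A plane partition is an array $\pi=(\pi_{ij})_{i,j\ge1}$ of nonnegative integers with finitely many nonzero entries satisfying $\pi_{ij}\ge\pi_{i+1,j}$ and $\pi_{ij}\ge\pi_{i,j+1}$. For a plane partition $\pi$, define $d_{i\ell}=|\{j:\pi_{ij}=\ell>\pi_{i+1,j}\}|$ for $i,\ell\ge1$, and $\Phi(\pi)=(d_{i\ell})_{i,\ell\ge1}$; for $\pi\in\mathrm{PP}(a,b,c)$ this is regarded as a $b\times c$ matrix $(d_{i\ell})_{1\le i\le b,1\le\ell\le c}$. *)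

(* Defs.v *)
From mathcomp Require Import all_boot all_order all_algebra.
From mathcomp Require Import finmap.
From mathcomp Require Import boolp classical_sets functions cardinality.

Set Implicit Arguments.
Unset Strict Implicit.
Unset Printing Implicit Defensive.

Local Open Scope classical_set_scope.
Local Open Scope card_scope.

(* All positions are numbered from 0: [pi i j] is the entry usually written    *)
(* pi_{i+1,j+1}.  Values of entries are not shifted.                           *)
Definition plane_partition : set (nat -> nat -> nat) :=
  [set pi | [/\ finite_set [set x : nat * nat | pi x.1 x.2 <> 0],
                forall i j, pi i.+1 j <= pi i j
              & forall i j, pi i j.+1 <= pi i j]].

Definition nonzero_rows (pi : nat -> nat -> nat) : set nat :=
  [set i | exists j, pi i j <> 0].

Definition nonzero_cols (pi : nat -> nat -> nat) : set nat :=
  [set j | exists i, pi i j <> 0].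

Definition PP (a b c : nat) : set (nat -> nat -> nat) :=
  [set pi | [/\ plane_partition pi,
                nonzero_rows pi #<= `I_b,
                nonzero_cols pi #<= `I_a
              & forall i j, pi i j <= c]].

Definition descent_cols (pi : nat -> nat -> nat) (i l : nat) : set nat :=
  [set j | pi i j = l /\ pi i.+1 j < l].

(* [fset_set] sends infinite sets to the empty one; this does not interfere    *)
(* here, see [finite_descent_cols].                                            *)
Definition descents (pi : nat -> nat -> nat) (i l : nat) : nat :=
  #|` fset_set (descent_cols pi i l)|.

Lemma finite_descent_cols pi i l :
  plane_partition pi -> finite_set (descent_cols pi i l).
Proof.
move=> [fin_pi _ _]; apply: (sub_finite_set _ (finite_image snd fin_pi)).
move=> j [<- lt_pi]; exists (i, j) => //=.
by move=> pi0; rewrite pi0 in lt_pi.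
Qed.

(* Column [k] corresponds to the value l = k + 1 >= 1.                         *)
Definition Phi (pi : nat -> nat -> nat) (i k : nat) : nat := descents pi i k.+1.

Definition Phi_mx (b c : nat) (pi : nat -> nat -> nat) : 'M[nat]_(b, c) :=
  \matrix_(i < b, k < c) Phi pi i k.

(* Cutting [Phi pi] down to a b x c matrix loses nothing on [PP a b c].         *)
Lemma Phi_out a b c pi i k :
  PP a b c pi -> (b <= i) || (c <= k) -> Phi pi i k = 0.
Proof.
move=> [[_ decr _] rows_pi _ le_pi] out.
suff E : descent_cols pi i k.+1 = set0.
  by rewrite /Phi /descents E fset_set0 cardfs0.
rewrite -subset0 => j [pi_k _].
case/orP: out => [le_bi | le_ck]; last first.
  by have := le_pi i j; rewrite pi_k ltnNge le_ck.
have decr_iter m : pi i j <= pi (i - m) j.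
  elim: m => [|m IHm]; first by rewrite subn0.
  have [lt_mi | le_im] := ltnP m i; last first.
    by move: IHm; rewrite (eqP le_im) (eqP (leqW le_im)).
  by apply: leq_trans IHm _; rewrite -[i - m]subnSK.
have sub : `I_i.+1 `<=` nonzero_rows pi.
  move=> r /= le_ri; exists j => pi0.
  by have := decr_iter (i - r); rewrite subKn // pi0 pi_k.
have := card_le_trans (subset_card_le sub) rows_pi.
by rewrite card_le_II ltnNge le_bi.
Qed.

Definition lattice_step (b c : nat) : rel ('I_b * 'I_c) :=
  fun x y => (y.1 == x.1.+1 :> nat) && (y.2 == x.2 :> nat)
          || (y.1 == x.1 :> nat) && (y.2 == x.2.+1 :> nat).

Definition lattice_path (b c : nat) (p : seq ('I_b * 'I_c)) : bool :=
  if p is x :: q then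
    [&& x.1 == 0 :> nat, x.2 == 0 :> nat, path (@lattice_step b c) x q,
        (last x q).1.+1 == b & (last x q).2.+1 == c]
  else false.

Definition path_support (b c : nat) (P : {set 'I_b * 'I_c}) : Prop :=
  exists2 p, lattice_path p & P = [set x in p]%SET.

(* G(b, c).  A default value 0 is used only if there is no path, i.e. if       *)
(* b = 0 or c = 0.                                                             *)
Definition last_passage_time (b c : nat) (D : 'M[nat]_(b, c)) : nat :=
  \max_(P : {set 'I_b * 'I_c} | `[< path_support P >])
    \sum_(x in P) D x.1 x.2.

Definition BM (a b c : nat) : set 'M[nat]_(b, c) :=
  [set D | last_passage_time D <= a].
Arguments BM : clear implicits.

(* Main.v *)
Require Import Defs.
From mathcomp Require Import all_boot all_order all_algebra.
From mathcomp Require Import finmap.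
From mathcomp Require Import boolp classical_sets functions cardinality.
From mathcomp Require Import zify.

Set Implicit Arguments.
Unset Strict Implicit.
Unset Printing Implicit Defensive.

Local Open Scope classical_set_scope.
Local Open Scope card_scope.

(** For a plane partition [pi], let [C i k] be the number of [j] with
    [pi i j > k].  As the rows are nonincreasing, [j < C i k] if and only if
    [k < pi i j], so the columns counted by [Phi pi i k] form the interval of
    the [j] with [maxn (C i.+1 k) (C i k.+1) <= j < C i k].  Hence
    [C i k = Phi pi i k + maxn (C i.+1 k) (C i k.+1)], which is the recursion
    for the last passage time from [(i, k)] to the opposite corner.  Thus [C],
    and with it [pi], is determined by the matrix, every matrix arises, and
    [C 0 0], the number of nonzero columns of [pi], is [G(b, c)]. *)

Definition passage_times b c (D : 'M[nat]_(b, c)) (W : nat -> nat -> nat) :=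
  (forall i k, (b <= i) || (c <= k) -> W i k = 0) /\
  (forall (i : 'I_b) (k : 'I_c), W i k = D i k + maxn (W i.+1 k) (W i k.+1)).

(** * Last passage times to the opposite corner *)

Section PassageTimes.
Variables (b c : nat) (D : 'M[nat]_(b, c)).

Lemma passage_times_exists : exists W, passage_times D W.
Proof.
pose d i k := if (insub i, insub k) is (Some i', Some k') then D i' k' else 0.
(* The fuel [n] makes the recursion structural. Started at [b - i + (c - k)], it drops by exactly
   one at either neighbour of a cell of the matrix, so the unfolded recursion matches the required
   equation. *)
pose fix V (n i k : nat) {struct n} := if n is m.+1 then
    if (i < b) && (k < c) then d i k + maxn (V m i.+1 k) (V m i k.+1) else 0
  else 0.
exists (fun i k => V (b - i + (c - k)) i k); split=> [i k out|i k].
  case: (_ + _) => [|n] //=; case: ifP => //; lia.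
have ltib := ltn_ord i; have ltkc := ltn_ord k.
have -> : b - i + (c - k) = (b - i.+1 + (c - k)).+1 by lia.
have -> : b - i + (c - k.+1) = b - i.+1 + (c - k) by lia.
by rewrite /= ltib ltkc /= /d !valK.
Qed.

Lemma passage_times_unique W W' :
  passage_times D W -> passage_times D W' -> W = W'.
Proof.
move=> [W0 WE] [W0' WE']; apply/funext => i; apply/funext => k.
have [n] := ubnP (b - i + (c - k)); elim: n => // n IHn in i k *.
move=> le_n; have [out|] := boolP ((b <= i) || (c <= k)).
  by rewrite W0 ?W0'.
rewrite negb_or -!ltnNge => /andP[ltib ltkc].
have := WE (Ordinal ltib) (Ordinal ltkc).
have /= -> := WE' (Ordinal ltib) (Ordinal ltkc); move=> ->.
by congr (_ + maxn _ _); apply: IHn; lia.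
Qed.

Variable W : nat -> nat -> nat.
Hypothesis WP : passage_times D W.

Lemma passage_times_nonincr i k : W i.+1 k <= W i k /\ W i k.+1 <= W i k.
Proof.
have [W0 WE] := WP; have [out|] := boolP ((b <= i) || (c <= k)).
  by rewrite !W0 //; lia.
rewrite negb_or -!ltnNge => /andP[ltib ltkc].
by have /= -> := WE (Ordinal ltib) (Ordinal ltkc); lia.
Qed.

(** Each step leads to one of the two arguments of the maximum in the recursion. The endpoint is
    left free, which lets the induction on the path go through. *)
Lemma lattice_path_weight_le x q :
  path (@lattice_step b c) x q -> \sum_(y <- x :: q) D y.1 y.2 <= W x.1 x.2.
Proof.
elim: q x => [|y q IHq] x /=.
  by rewrite big_seq1 WP.2 leq_addr.
case/andP=> step /IHq le_yq; rewrite big_cons WP.2 leq_add2l.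
apply: leq_trans le_yq _; rewrite leq_max.
by case/orP: step => /andP[/eqP-> /eqP->]; rewrite leqnn ?orbT.
Qed.

(** A greedy path attains the bound: it always moves to a neighbour inside the matrix where the
    maximum is reached. *)
Lemma lattice_path_weight_eq (i : 'I_b) (k : 'I_c) :
  exists q, [/\ path (@lattice_step b c) (i, k) q,
    (last (i, k) q).1.+1 = b, (last (i, k) q).2.+1 = c
    & \sum_(y <- (i, k) :: q) D y.1 y.2 = W i k].
Proof.
have [W0 WE] := WP.
have [n] := ubnP (b - i + (c - k)); elim: n => // n IHn in i k *.
move=> le_n; have ltib := ltn_ord i; have ltkc := ltn_ord k.
have [/andP[ltk leW]|right] := boolP ((k.+1 < c) && (W i.+1 k <= W i k.+1)).
  have [|q [pq q1 q2 sq]] := IHn i (Ordinal ltk); first by move=> /=; lia.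
  exists ((i, Ordinal ltk) :: q); split=> //=.
    by rewrite pq andbT /lattice_step /= !eqxx orbT.
  by rewrite big_cons sq [RHS]WE (maxn_idPr leW).
have [/andP[lti leW]|down] := boolP ((i.+1 < b) && (W i k.+1 <= W i.+1 k)).
  have [|q [pq q1 q2 sq]] := IHn (Ordinal lti) k; first by move=> /=; lia.
  exists ((Ordinal lti, k) :: q); split=> //=.
    by rewrite pq andbT /lattice_step /= !eqxx.
  by rewrite big_cons sq [RHS]WE (maxn_idPl leW).
(* If neither move is possible, the cell is the opposite corner: [W] vanishes outside the matrix, so
   a neighbour that lies inside while the other does not always reaches the maximum. *)
have bi : i.+1 = b.
  apply/eqP; rewrite eqn_leq ltib leqNgt; apply: contra down => lti.
  rewrite lti /=; move: right; rewrite negb_and -leqNgt.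
  by case/orP=> [lek|]; [rewrite (W0 i k.+1) // lek orbT | lia].
have ck : k.+1 = c.
  apply/eqP; rewrite eqn_leq ltkc leqNgt; apply: contra right => ltk.
  by rewrite ltk (W0 i.+1 k) // bi leqnn.
exists [::]; split=> //=.
by rewrite big_seq1 WE W0 ?W0 ?bi ?ck ?leqnn ?orbT // maxn0 addn0.
Qed.

(** The sum of the coordinates increases along a path. Hence summing over the support, as
    [last_passage_time] does, loses no multiplicity. *)
Lemma lattice_path_uniq (p : seq ('I_b * 'I_c)) : lattice_path p -> uniq p.
Proof.
case: p => // x q /and5P[_ _ path_q _ _].
pose r := [rel y z : 'I_b * 'I_c | y.1 + y.2 < z.1 + z.2].
have trr : transitive r by move=> ? ? ?; apply: ltn_trans.
have irr : irreflexive r by move=> y /=; rewrite ltnn.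
apply: (sorted_uniq trr irr) => /=; apply: sub_path path_q => y z.
by case/orP => /andP[/eqP e1 /eqP e2] /=; rewrite e1 e2; lia.
Qed.

Lemma last_passage_timeE : 0 < b -> 0 < c -> last_passage_time D = W 0 0.
Proof.
move=> b_gt0 c_gt0.
have sum_support p : lattice_path p ->
    \sum_(x in [set x in p]%SET) D x.1 x.2 = \sum_(x <- p) D x.1 x.2.
  move=> /lattice_path_uniq uniq_p; rewrite [RHS]big_uniq //.
  by apply: eq_bigl => x; rewrite inE.
apply/eqP; rewrite eqn_leq; apply/andP; split.
  apply/bigmax_leqP => P /asboolP[p path_p ->]; rewrite sum_support //.
  case: p path_p => // x q /and5P[/eqP x1 /eqP x2 path_q _ _].
  by have := lattice_path_weight_le path_q; rewrite x1 x2.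
have [q [path_q q1 q2 <-]] :=
  lattice_path_weight_eq (Ordinal b_gt0) (Ordinal c_gt0).
have path_p : lattice_path ((Ordinal b_gt0, Ordinal c_gt0) :: q).
  by rewrite /= path_q q1 q2 !eqxx.
rewrite -sum_support //.
apply: (@leq_bigmax_cond _ _ (fun P : {set _} => \sum_(x in P) D x.1 x.2)).
by apply/asboolP; exists ((Ordinal b_gt0, Ordinal c_gt0) :: q).
Qed.

End PassageTimes.

(** * Conjugates of nonincreasing sequences *)

(* [find] returns [n] if no [j < n] satisfies the predicate, so for nonincreasing
   [f] this is the number of [j < n] with [k < f j]. *)
Definition conjugate n (f : nat -> nat) (k : nat) : nat :=
  find (fun j => f j <= k) (iota 0 n).

Lemma nonincr_leq (f : nat -> nat) i j :
  (forall m, f m.+1 <= f m) -> i <= j -> f j <= f i.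
Proof.
move=> decr /subnKC <-; elim: (j - i) => [|m IHm]; first by rewrite addn0.
by rewrite addnS; apply: leq_trans IHm.
Qed.

(** By monotonicity the [j] with [k < f j] form an initial segment, and the vanishing of [f] from
    [n] on makes it harmless to stop the search at [n]. *)
Lemma ltn_conjugate n f k j :
  (forall m, f m.+1 <= f m) -> (forall m, n <= m -> f m = 0) ->
  (j < conjugate n f k) = (k < f j).
Proof.
move=> decr f0; apply/idP/idP => [lt_j|lt_k].
  have lt_jn : j < n.
    by apply: leq_trans lt_j _; rewrite -[leqRHS](size_iota 0) find_size.
  by have := before_find 0 lt_j; rewrite nth_iota // add0n ltnNge => ->.
rewrite ltnNge; apply/negP => le_j.
have lt_jn : j < n by rewrite ltnNge; apply: contraL lt_k => /f0 ->.
have lt_fn : find (fun j => f j <= k) (iota 0 n) < n by apply: leq_ltn_trans lt_jn.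
have := nth_find 0 (_ : has (fun j => f j <= k) (iota 0 n)).
rewrite has_find size_iota nth_iota // add0n => /(_ lt_fn) le_k.
by have := leq_trans (nonincr_leq decr le_j) le_k; rewrite leqNgt lt_k.
Qed.

Lemma eq_from_ltn m n : (forall j, (j < m) = (j < n)) -> m = n.
Proof.
move=> E; apply/eqP; rewrite eqn_leq.
by apply/andP; split; rewrite leqNgt; [rewrite E | rewrite -E]; rewrite ltnn.
Qed.

Lemma card_fset_set_itv m n : #|` fset_set [set j | m <= j < n]| = n - m.
Proof.
have -> : [set j | m <= j < n] = [set` [fset j in iota m (n - m)]%fset].
  by apply/seteqP; split=> j /=; rewrite !inE mem_iota; lia.
by rewrite set_fsetK card_fseq undup_id ?iota_uniq // size_iota.
Qed.

(** This turns the bounds on the number of nonzero rows and columns into bounds on their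
    positions. *)
Lemma card_le_downset (A : set nat) n :
  (forall i j, i <= j -> A j -> A i) -> A #<= `I_n -> forall i, A i -> i < n.
Proof.
move=> downA leA i Ai; rewrite -card_le_II; apply: card_le_trans leA.
by apply: subset_card_le => j /= le_j; apply: downA Ai.
Qed.

(** * From a plane partition to passage times *)

Section RowConjugates.
Variables (a b c : nat) (pi : nat -> nat -> nat).
Hypothesis PPpi : PP a b c pi.

Lemma PP_row_out i j : b <= i -> pi i j = 0.
Proof.
have [[_ decr _] rows _ _] := PPpi.
move=> le_bi; apply: contraTeq le_bi => /eqP nz; rewrite -ltnNge.
apply: (card_le_downset _ rows); last by exists j.
move=> r s le_rs [l /eqP nz_l]; exists l; apply/eqP; rewrite -lt0n.
by apply: leq_trans (nonincr_leq (decr ^~ l) le_rs); rewrite lt0n.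
Qed.

Lemma PP_col_out i j : a <= j -> pi i j = 0.
Proof.
have [[_ _ decr] _ cols _] := PPpi.
move=> le_aj; apply: contraTeq le_aj => /eqP nz; rewrite -ltnNge.
apply: (card_le_downset _ cols); last by exists i.
move=> r s le_rs [l /eqP nz_l]; exists l; apply/eqP; rewrite -lt0n.
by apply: leq_trans (nonincr_leq (decr l) le_rs); rewrite lt0n.
Qed.

Lemma ltn_row_conjugate i j k : (j < conjugate a (pi i) k) = (k < pi i j).
Proof.
by have [[_ _ decr] _ _ _] := PPpi; apply: ltn_conjugate => // m /PP_col_out.
Qed.

Lemma PhiE i k : Phi pi i k = conjugate a (pi i) k -
  maxn (conjugate a (pi i.+1) k) (conjugate a (pi i) k.+1).
Proof.
rewrite /Phi /descents -card_fset_set_itv; congr #|` fset_set _|.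
(* The three inequalities on [j] become [pi i.+1 j <= k], [pi i j <= k.+1] and [k < pi i j]. *)
apply/seteqP; split=> j; rewrite /descent_cols /= geq_max ltn_row_conjugate;
  rewrite [_ <= j]leqNgt [X in _ && X && _]leqNgt !ltn_row_conjugate; lia.
Qed.

Lemma row_conjugate_passage_times :
  passage_times (Phi_mx b c pi) (fun i k => conjugate a (pi i) k).
Proof.
have [[_ decr _] _ _ le_c] := PPpi; split=> [i k out|i k].
  apply: eq_from_ltn => j; rewrite ltn_row_conjugate ltn0; apply/negbTE.
  rewrite -leqNgt; case/orP: out => [/PP_row_out-> //|le_ck].
  exact: leq_trans (le_c i j) le_ck.
(* The truncated subtraction in [PhiE] is exact, because the conjugates decrease in both [i] and
   [k]. *)
rewrite mxE PhiE subnK // geq_max; apply/andP; split; rewrite leqNgt;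
  apply/negP; rewrite ltn_row_conjugate ltnNge => /negP; apply.
  apply: leq_trans (decr _ _) _.
  by rewrite leqNgt -ltn_row_conjugate ltnn.
by apply: leqW; rewrite leqNgt -ltn_row_conjugate ltnn.
Qed.

End RowConjugates.

(** This builds the preimage for surjectivity. Monotonicity of [W] in [k] makes conjugation of its
    rows meaningful, and monotonicity in [i] makes the columns of [pi] nonincreasing and bounds
    every [W i 0] by [a]. *)
Lemma plane_partition_of_passage_times a b c (D : 'M[nat]_(b, c)) W :
  passage_times D W -> W 0 0 <= a ->
  let pi i j := conjugate c (W i) j in
  PP a b c pi /\ (forall i j k, (k < pi i j) = (j < W i k)).
Proof.
move=> WP le_a pi.
have decrW := passage_times_nonincr WP.
have ltpi i j k : (k < pi i j) = (j < W i k).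
  apply: ltn_conjugate => m; first by have [] := decrW i m.
  by move=> le_cm; rewrite WP.1 // le_cm orbT.
have le_pi i j i' j' : (forall k, j < W i k -> j' < W i' k) -> pi i j <= pi i' j'.
  by move=> H; rewrite leqNgt ltpi; apply/negP => /H; rewrite -ltpi ltnn.
have supp i j : pi i j <> 0 -> i < b /\ j < a.
  move/eqP; rewrite -lt0n ltpi => lt_j; split.
    by rewrite ltnNge; apply: contraL lt_j => le_bi; rewrite WP.1 ?le_bi.
  apply: leq_trans lt_j (leq_trans _ le_a).
  by apply: (@nonincr_leq (W ^~ 0)) => // m; have [] := decrW m 0.
split=> //; split.
- split=> [|i j|i j].
  + apply: sub_finite_set (finite_setX (finite_II b) (finite_II a)).
    by move=> [i j] /= /supp.
  + by apply: le_pi => k lt_j; apply: leq_trans lt_j _; have [] := decrW i k.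
  + by apply: le_pi => k; apply: ltnW.
- by apply: subset_card_le => i [j /supp[]].
- by apply: subset_card_le => j [i /supp[]].
- move=> i j; rewrite leqNgt ltpi WP.1 ?leqnn ?orbT //.
Qed.

Theorem theorem2p2 (a b c : nat) :
  0 < a -> 0 < b -> 0 < c ->
  set_bij (PP a b c) (BM a b c) (Phi_mx b c).
Proof.
move=> _ b_gt0 c_gt0; split.
- move=> pi PPpi /=; rewrite /BM /=.
  rewrite (last_passage_timeE (row_conjugate_passage_times PPpi)) //.
  (* The passage time from the first cell is a search position in a list of length [a]. *)
  by rewrite -[leqRHS](size_iota 0) find_size.
- move=> pi pi' /set_mem PPpi /set_mem PPpi' eq_mx.
  have := row_conjugate_passage_times PPpi'; rewrite -eq_mx => WP'.
  have eqW := passage_times_unique (row_conjugate_passage_times PPpi) WP'.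
  apply/funext => i; apply/funext => j; apply: eq_from_ltn => k.
  rewrite -(ltn_row_conjugate PPpi) -(ltn_row_conjugate PPpi').
  by have -> := congr1 (fun W => W i k) eqW.
- move=> D; rewrite /BM /= => le_a.
  have [W WP] := passage_times_exists D.
  rewrite (last_passage_timeE WP) // in le_a.
  have [PPpi ltpi] := plane_partition_of_passage_times WP le_a.
  exists (fun i j => conjugate c (W i) j) => //.
  (* Conjugating twice gives back [W], so [PhiE] recovers the matrix from the recursion. *)
  have conjW i k : conjugate a (conjugate c (W i)) k = W i k.
    apply: eq_from_ltn => j.
    by rewrite (ltn_row_conjugate PPpi i) ltpi.
  apply/matrixP => i k; rewrite mxE (PhiE PPpi) !conjW WP.2.
  exact: addnK.
Qed.
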